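(* Consider the Norros-Reittu random graph process started from a graph with a single node, in which exactly one new node is added at each evolution step, so that the number of nodes after step $k$ is $N_k=k+1$. Let $\lambda>0$ and $T^*>0$ be fixed and let $K^*$ be the number of evolution steps up to time $T^*$, where evolution steps occur at the ticks of a Poisson process of intensity $\lambda$. Then $$P\{N_{K^*}=i\}=\frac{(\lambda T^* )^{i-1}e^{-\lambda T^*}}{(i-1)!},\qquad i\ge 1.$$
   Context: The graph $G_k$ after evolution step $k$ has node set $V_k$, with $N_k=\#V_k$ and $N_0=1$; in the Norros-Reittu model each evolution step adds exactly one node (and random edges, which are irrelevant here). The number $\nu(t)$ of ticks of the clock in time $t$ satisfies $P\{\nu(t)=k\}=(\lambda t)^k e^{-\lambda t}/k!$ for $k=0,1,2,\dots$, and $K^*=\nu(T^* )$. *)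

(* Defs.v *)
From HB Require Import structures.
From mathcomp Require Import all_boot all_order all_algebra finmap.
From mathcomp Require Import all_classical all_reals all_analysis.
Set Implicit Arguments.
Unset Strict Implicit.
Unset Printing Implicit Defensive.
Import Order.TTheory GRing.Theory Num.Theory.
Import numFieldNormedType.Exports.
Local Open Scope classical_set_scope.
Local Open Scope ring_scope.

(* Finite undirected graphs; parallel edges and loops are allowed, as they are
   in the Norros-Reittu model. *)
Record multigraph (V : countType) := Multigraph {
  nodes : {fset V} ;
  edges : V -> V -> nat ;
  edges_sym : forall x y, edges x y = edges y x ;
  edges_nodes : forall x y, (0 < edges x y)%N -> x \in nodes /\ y \in nodes }.

(* [G k] is the graph after evolution step [k].  The law of the edges is left
   arbitrary: at each step edges may be created or deleted at random, in any
   way that depends on the past, on node capacities, and so on. *)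
Definition random_graph_process d (Omega : measurableType d) (V : countType)
    (G : nat -> Omega -> multigraph V) : Prop :=
  (forall k (A : {fset V}), measurable [set w | nodes (G k w) = A]) /\
  (forall k x y m, measurable [set w | edges (G k w) x y = m]).

Definition single_node_start (Omega : Type) (V : countType)
    (G : nat -> Omega -> multigraph V) : Prop :=
  forall w, exists v, nodes (G 0%N w) = [fset v]%fset.

Definition one_new_node_per_step (Omega : Type) (V : countType)
    (G : nat -> Omega -> multigraph V) : Prop :=
  forall k w, exists2 v, v \notin nodes (G k w) &
    nodes (G k.+1 w) = (v |` nodes (G k w))%fset.

(* N_k = #V_k *)
Definition num_nodes (Omega : Type) (V : countType)
    (G : nat -> Omega -> multigraph V) (k : nat) (w : Omega) : nat :=
  #|` nodes (G k w)|.

(* A clock is given by the times [tau 0 < tau 1 < ...] of its ticks; only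
   finitely many of them fall in a bounded time interval. *)
Definition tick_times (R : realType) (Omega : Type)
    (tau : nat -> Omega -> R) : Prop :=
  forall w, [/\ 0 < tau 0%N w,
    forall n, tau n w < tau n.+1 w &
    tau n w @[n --> \oo] --> +oo].

(* nu(t): [fset_set] of an infinite set is empty, but for [tick_times] the set
   below is finite. *)
Definition num_ticks (R : realType) (Omega : Type)
    (tau : nat -> Omega -> R) (t : R) (w : Omega) : nat :=
  #|` fset_set [set n | tau n w <= t]|.

(* The product rule over all values of the increments over consecutive
   intervals is mutual independence, the increments being integer-valued.
   [num_ticks] is nondecreasing in time, so that the truncated subtraction is
   the actual one. *)
Definition independent_increments (R : realType) d (Omega : measurableType d)
    (P : probability Omega R) (nu : R -> Omega -> nat) : Prop :=
  forall (n : nat) (t : nat -> R) (k : nat -> nat),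
    0 <= t 0%N -> {homo t : i j / (i <= j)%N >-> i <= j} ->
    P (\bigcap_(j in `I_n) [set w | (nu (t j.+1) w - nu (t j) w)%N = k j]) =
    (\prod_(j < n) P [set w | (nu (t j.+1) w - nu (t j) w)%N = k j])%E.

Definition poisson_increments (R : realType) d (Omega : measurableType d)
    (P : probability Omega R) (lambda : R) (nu : R -> Omega -> nat) : Prop :=
  forall (s t : R) (k : nat), 0 <= s -> s <= t ->
    P [set w | (nu t w - nu s w)%N = k] =
    ((lambda * (t - s)) ^+ k * expR (- (lambda * (t - s))) / k`!%:R)%:E.

Definition poisson_clock (R : realType) d (Omega : measurableType d)
    (P : probability Omega R) (lambda : R)
    (tau : nat -> {RV P >-> R}) : Prop :=
  let tau' := fun n => tau n : Omega -> R in
  [/\ tick_times tau',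
      independent_increments P (num_ticks tau') &
      poisson_increments P lambda (num_ticks tau')].

(* Main.v *)
Require Import Defs.
From HB Require Import structures.
From mathcomp Require Import all_boot all_order all_algebra finmap.
From mathcomp Require Import all_classical all_reals all_analysis.
Import Order.TTheory GRing.Theory Num.Theory.
Import numFieldNormedType.Exports.
Local Open Scope classical_set_scope.
Local Open Scope ring_scope.

(** The node count is deterministic: [num_nodesE] gives k+1 nodes after step k for every outcome, so
    the identity survives substituting the random index [Kstar w]. The event of having i nodes is
    thus the event of i-1 ticks up to [Tstar], whose probability is the Poisson one. *)

Lemma num_nodesE (Omega : Type) (V : countType)
    (G : nat -> Omega -> multigraph V) (k : nat) (w : Omega) :
  single_node_start G -> one_new_node_per_step G -> num_nodes G k w = k.+1.
Proof.
move=> hG0 hG1; rewrite /num_nodes; elim: k => [|k IHk].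
  by have [v ->] := hG0 w; rewrite cardfs1.
by have [v vk ->] := hG1 k w; rewrite cardfsU1 vk IHk.
Qed.

(** The Poisson law is given for increments of the tick count; this turns the increment from time 0
    into the count itself. The first tick is strictly positive and later ones are larger. *)
Lemma num_ticks0 (R : realType) (Omega : Type) (tau : nat -> Omega -> R)
    (w : Omega) :
  tick_times tau -> num_ticks tau 0 w = 0%N.
Proof.
move=> /(_ w)[tau0_gt0 tau_lt _].
have tau_gt0 n : 0 < tau n w.
  by elim: n => [//|n IHn]; exact: lt_trans IHn (tau_lt n).
rewrite /num_ticks (_ : [set n | _] = set0) ?fset_set0 ?cardfs0//.
by rewrite -subset0 => n /=; rewrite leNgt tau_gt0.
Qed.

Theorem lemma3 (R : realType) (d : measure_display) (Omega : measurableType d)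
    (P : probability Omega R) (V : countType)
    (G : nat -> Omega -> multigraph V)
    (lambda Tstar : R) (tau : nat -> {RV P >-> R})
    (hG : random_graph_process G)
    (hG0 : single_node_start G)
    (hG1 : one_new_node_per_step G)
    (lambda_gt0 : 0 < lambda) (Tstar_gt0 : 0 < Tstar)
    (htau : poisson_clock lambda tau) :
  let Kstar := num_ticks tau Tstar in
  (forall k w, num_nodes G k w = k.+1) /\
  (forall i : nat, (1 <= i)%N ->
    P [set w | num_nodes G (Kstar w) w = i] =
    ((lambda * Tstar) ^+ i.-1 * expR (- (lambda * Tstar)) / (i.-1)`!%:R)%:E).
Proof.
move=> Kstar; split=> [k w|[//|i] _]; first exact: num_nodesE.
have [ticks _ poisson] := htau.
(* Here [i] is the original index minus one, hence a number of ticks. Rewriting backwards leaves an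
   equality of two probabilities. *)
have := poisson 0 Tstar i (lexx 0) (ltW Tstar_gt0); rewrite subr0 => <-.
(* The two events coincide outcome by outcome: [(Kstar w).+1 = i.+1] exactly when [Kstar w = i]. *)
congr (P _); apply/seteqP; split=> w /=;
  rewrite num_nodesE// num_ticks0// subn0; first by case.
by rewrite /Kstar => ->.
Qed.
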